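(* Let $\mathcal{X}\subseteq\mathbb{R}^d$ be a convex and compact set with diameter $R$ (so $\|x_1-x_2\|\le R$ for all $x_1,x_2\in\mathcal{X}$). Let $f:\mathbb{R}^d\to\mathbb{R}$ be differentiable, $\mu$-strongly convex on $\mathcal{X}$ and $\beta$-smooth on $\mathcal{X}$, with $\mu,\beta>0$. Let $x^\star$ be the unique minimizer of $f$ over $\mathcal{X}$, and assume that $\mathcal{X}$ contains a non-empty ball (of positive radius) centered at $x^\star$. Let $\kappa=\beta/\mu$ be the condition number of $f$. Suppose that the corruption probability $p\ge0$ satisfies $$p<\frac{1}{1+\kappa}.$$ Let $q\in\left[p,\frac{1}{1+\kappa}\right)$, let $$\gamma=\frac{\kappa R}{2\left((1-q)-q\kappa\right)},$$ and set the step sizes $\gamma_t=\gamma/t$ for $t\ge1$. Then the iterates $(x_t)_{t\ge1}$ generated by the normalized subgradient method with randomly corrupted gradients (corruption probability $p$, arbitrary corrupt feedback $b_t$), started from any $x_1\in\mathcal{X}$, satisfy, for every $T\ge1$, $$\mathbb{E}\left[\|x_{T+1}-x^\star\|^2\right]\le\frac{\gamma^2(1+\log T)}{T},$$ and $$\lim_{t\to\infty}x_t=x^\star\quad\text{almost surely}.$$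
   Context: $\|\cdot\|$ is the Euclidean norm on $\mathbb{R}^d$, $\langle\cdot,\cdot\rangle$ the standard inner product, $\Pi_{\mathcal{X}}$ the Euclidean projection onto $\mathcal{X}$, and $g(x)=\nabla f(x)$. $f$ is $\beta$-smooth on $\mathcal{X}$ if $\|g(x_1)-g(x_2)\|\le\beta\|x_1-x_2\|$ for all $x_1,x_2\in\mathcal{X}$. $f$ is $\mu$-strongly convex on $\mathcal{X}$ if $\langle g(x_1)-g(x_2),x_1-x_2\rangle\ge\mu\|x_1-x_2\|^2$ for all $x_1,x_2\in\mathcal{X}$. Randomly corrupted feedback: at each iteration $t\ge1$, given $x_t$, the received feedback is $h_t=g(x_t)$ if $Y_t=0$ and $h_t=b_t$ if $Y_t=1$, where $Y_t$ is a Bernoulli($p$) random variable ($\mathbb{P}(Y_t=1)=p$) independent of the history up to the beginning of iteration $t$ (i.e. of $x_1,\dots,x_t$, $Y_1,\dots,Y_{t-1}$, $b_1,\dots,b_{t-1}$). The corrupt feedback $b_t$ is an arbitrary $\mathbb{R}^d$-valued random vector, with no bound on its norm or moments; it may be chosen by an adversary with full knowledge of the problem. Normalized subgradient method: start from a (deterministic) $x_1\in\mathcal{X}$; for $t=1,2,\dots$, set $$x_{t+1}=\Pi_{\mathcal{X}}\left(x_t-\gamma_t\frac{h_t}{\|h_t\|}\right)\ \text{ if }\|h_t\|>0,\qquad x_{t+1}=x_t\ \text{ if }\|h_t\|=0.$$ *)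

(* Defs.v *)
From HB Require Import structures.
From mathcomp Require Import all_boot all_order all_algebra.
From mathcomp Require Import all_classical all_reals all_analysis.

Set Implicit Arguments.
Unset Strict Implicit.
Unset Printing Implicit Defensive.

Import Order.TTheory GRing.Theory Num.Theory.
Import numFieldNormedType.Exports.

Local Open Scope classical_set_scope.
Local Open Scope ring_scope.

(* The library norm on 'rV[R]_d is the sup norm, hence the explicit Euclidean
   inner product and norm. The topology of 'rV[R]_d is the usual one. *)
Definition inner (R : realType) (d : nat) (u v : 'rV[R]_d) : R :=
  \sum_(i < d) u 0 i * v 0 i.

Definition enorm (R : realType) (d : nat) (u : 'rV[R]_d) : R :=
  Num.sqrt (inner u u).

Definition diameter (R : realType) (d : nat) (X : set 'rV[R]_d) : R :=
  sup [set enorm (u.1 - u.2) | u in X `*` X].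

Definition gradient (R : realType) (d : nat) (f : 'rV[R]_d -> R)
    (u : 'rV[R]_d) : 'rV[R]_d :=
  \row_(i < d) 'D_(delta_mx 0 i) f u.

Definition smooth_on (R : realType) (d : nat) (X : set 'rV[R]_d)
    (f : 'rV[R]_d -> R) (beta : R) : Prop :=
  forall u v, X u -> X v ->
    enorm (gradient f u - gradient f v) <= beta * enorm (u - v).

Definition strongly_convex_on (R : realType) (d : nat) (X : set 'rV[R]_d)
    (f : 'rV[R]_d -> R) (mu : R) : Prop :=
  forall u v, X u -> X v ->
    mu * enorm (u - v) ^+ 2 <= inner (gradient f u - gradient f v) (u - v).

Definition minimizers (R : realType) (d : nat) (X : set 'rV[R]_d)
    (f : 'rV[R]_d -> R) : set 'rV[R]_d :=
  [set u | X u /\ forall v, X v -> f u <= f v].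

(* For X nonempty, closed and convex the minimizer selected by get is unique. *)
Definition projection (R : realType) (d : nat) (X : set 'rV[R]_d)
    (u : 'rV[R]_d) : 'rV[R]_d :=
  get (minimizers X (fun v => enorm (u - v))).

(* 'rV[R]_d carries no measurable structure; this alias has the Borel one. *)
Definition borelV (R : realType) (d : nat) :=
  g_sigma_algebraType (@open 'rV[R]_d).

Definition random_vector (disp : measure_display) (Om : measurableType disp)
    (R : realType) (d : nat) (Z : Om -> 'rV[R]_d) : Prop :=
  measurable_fun setT (Z : Om -> borelV R d).

Definition independent_sets (disp : measure_display) (Om : measurableType disp)
    (R : realType) (P : probability Om R) (F G : set (set Om)) : Prop :=
  forall A B, F A -> G B -> P (A `&` B) = (P A * P B)%E.

(* The sigma-algebra generated by x_1, ..., x_t, Y_1, ..., Y_(t-1) and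
   b_1, ..., b_(t-1). It does not involve b_t, which may depend on Y_t. *)
Definition history (disp : measure_display) (Om : measurableType disp)
    (R : realType) (d : nat) (x b : nat -> Om -> 'rV[R]_d)
    (Y : nat -> Om -> bool) (t : nat) : set (set Om) :=
  <<s \bigcup_(s in [set s | (1 <= s <= t)%N])
        g_sigma_algebra_preimage (x s : Om -> borelV R d)
      `|` \bigcup_(s in [set s | (1 <= s < t)%N])
        (g_sigma_algebra_preimage (Y s)
         `|` g_sigma_algebra_preimage (b s : Om -> borelV R d)) >>.

Definition feedback (Om : Type) (R : realType) (d : nat)
    (f : 'rV[R]_d -> R) (x b : nat -> Om -> 'rV[R]_d)
    (Y : nat -> Om -> bool) (t : nat) (w : Om) : 'rV[R]_d :=
  if Y t w then b t w else gradient f (x t w).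

Definition normalized_step (R : realType) (d : nat) (X : set 'rV[R]_d)
    (eta : R) (u h : 'rV[R]_d) : 'rV[R]_d :=
  if 0 < enorm h then projection X (u - eta *: ((enorm h)^-1 *: h)) else u.

(* Time starts at 1; x 0 is irrelevant. *)
Definition normalized_subgradient_method (Om : Type) (R : realType) (d : nat)
    (X : set 'rV[R]_d) (step : nat -> R) (x1 : 'rV[R]_d)
    (h x : nat -> Om -> 'rV[R]_d) : Prop :=
  (forall w, x 1%N w = x1) /\
  (forall t w, (1 <= t)%N ->
     x t.+1 w = normalized_step X (step t) (x t w) (h t w)).

Definition corruption_model (disp : measure_display) (Om : measurableType disp)
    (R : realType) (P : probability Om R) (d : nat) (p : R)
    (x b : nat -> Om -> 'rV[R]_d) (Y : nat -> {RV P >-> bool}) : Prop :=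
  forall t, (1 <= t)%N ->
    [/\ P (Y t @^-1` [set true]) = p%:E,
        independent_sets P (g_sigma_algebra_preimage (Y t))
          (history x b (fun s => Y s : Om -> bool) t) &
        random_vector (b t)].

(* Main.v *)
Require Import Defs.
From HB Require Import structures.
From mathcomp Require Import all_boot all_order all_algebra.
From mathcomp Require Import all_classical all_reals all_analysis.
From mathcomp Require Import measurable_realfun.
From mathcomp Require Import zify ring lra.


(** Let z = x_t - x* be the error at time t. As x* is an interior minimizer, the
    gradient vanishes there, so strong convexity and smoothness force the
    normalized gradient at x_t to make progress: its inner product with z is at
    least |z| / kappa ([alignment_gradient]). A corrupt unit vector loses at most
    |z| ([alignment_ge]), however large it is before normalization and however it
    was chosen. Projecting onto X does not increase distances to points of X
    ([projection_nonexpansive]), hence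
      |z_(t+1)|^2 <= |z_t|^2 + gamma_t^2
                     - 2 gamma_t ((1 - Y_t) / kappa - Y_t) |z_t|.

    Taking expectations, the only probabilistic input is that Y_t is independent
    of |z_t|, which gives E[Y_t |z_t|] = p E|z_t| ([corrupt_dist_mean]). The drift
    is then proportional to (1 - p) / kappa - p, positive under the hypothesis on
    p. With the chosen gamma, and since |z|^2 <= R |z|, the means
    a_t = E|z_t|^2 satisfy a_(t+1) <= (1 - 1/t) a_t + gamma^2 / t^2
    ([mean_sqr_dist_recursion]). So t a_(t+1) <= (t - 1) a_t + gamma^2 / t, which
    telescopes to the rate by comparing the harmonic sum with the logarithm
    ([log_rate]).

    Almost sure convergence follows from the rate without martingale theory. Along
    the times k^3 + 1 the means are summable, so |z_t|^2 tends to 0 almost surely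
    along them ([ae_cvg0_cube]); and since each iterate moves by at most
    gamma / t, the distance varies by O(1 / k) between consecutive such times
    ([cvg_from_cube_times]).

    For expectations to behave, the iterates must be Borel measurable: this
    reduces to coordinates ([coord_random_vector]), the gradient being a limit of
    difference quotients ([gradient_random_vector]). *)

Set Implicit Arguments.
Unset Strict Implicit.
Unset Printing Implicit Defensive.

Import Order.TTheory GRing.Theory Num.Theory.
Import numFieldNormedType.Exports.

Local Open Scope classical_set_scope.
Local Open Scope ring_scope.

(** * Euclidean geometry and projection onto a compact convex set *)

Section Euclidean.
Context {R : realType} {d : nat}.
Implicit Types u v w : 'rV[R]_d.

Lemma innerC u v : inner u v = inner v u.
Proof. by apply: eq_bigr => i _; rewrite mulrC. Qed.

Lemma innerDl u v w : inner (u + v) w = inner u w + inner v w.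
Proof.
by rewrite /inner -big_split /=; apply: eq_bigr => i _; rewrite mxE mulrDl.
Qed.

Lemma innerZl a u v : inner (a *: u) v = a * inner u v.
Proof.
by rewrite /inner mulr_sumr; apply: eq_bigr => i _; rewrite mxE mulrA.
Qed.

Lemma innerNl u v : inner (- u) v = - inner u v.
Proof. by rewrite -scaleN1r innerZl mulN1r. Qed.

Lemma innerDr u v w : inner w (u + v) = inner w u + inner w v.
Proof. by rewrite innerC innerDl !(innerC w). Qed.

Lemma innerZr a u v : inner u (a *: v) = a * inner u v.
Proof. by rewrite innerC innerZl innerC. Qed.

Lemma innerNr u v : inner u (- v) = - inner u v.
Proof. by rewrite innerC innerNl innerC. Qed.

Definition innerE := (innerDl, innerDr, innerNl, innerNr, innerZl, innerZr).

Lemma inner0r u : inner u 0 = 0.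
Proof. by rewrite -(scale0r 0) innerZr mul0r. Qed.

Lemma inner_ge0 u : 0 <= inner u u.
Proof. by apply: sumr_ge0 => i _; rewrite -expr2 sqr_ge0. Qed.

Lemma enorm_ge0 u : 0 <= enorm u.
Proof. exact: sqrtr_ge0. Qed.

Lemma sqr_enorm u : enorm u ^+ 2 = inner u u.
Proof. by rewrite sqr_sqrtr// inner_ge0. Qed.

Lemma enorm_le u r : 0 <= r -> (enorm u <= r) = (inner u u <= r ^+ 2).
Proof. by move=> r0; rewrite -sqr_enorm ler_sqr ?nnegrE// enorm_ge0. Qed.

Lemma enorm0 : enorm (0 : 'rV[R]_d) = 0.
Proof. by rewrite /enorm inner0r sqrtr0. Qed.

Lemma enorm_eq0 u : enorm u = 0 -> u = 0.
Proof.
move=> u0; have : inner u u = 0 by rewrite -sqr_enorm u0 expr0n.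
move/eqP; rewrite psumr_eq0; last by move=> i _; rewrite -expr2 sqr_ge0.
move=> /allP u0i; apply/rowP => i; rewrite mxE; apply/eqP.
by have := u0i i; rewrite mem_index_enum mulf_eq0 orbb; apply.
Qed.

Lemma enormN u : enorm (- u) = enorm u.
Proof. by rewrite /enorm innerNl innerNr opprK. Qed.

Lemma enormB u v : enorm (u - v) = enorm (v - u).
Proof. by rewrite -enormN opprB. Qed.

Lemma cauchy_schwarz u v : inner u v <= enorm u * enorm v.
Proof.
have [/enorm_eq0 ->|u0] := eqVneq (enorm u) 0.
  by rewrite innerC inner0r enorm0 mul0r.
have [/enorm_eq0 ->|v0] := eqVneq (enorm v) 0.
  by rewrite inner0r enorm0 mulr0.
have uv0 : 0 < enorm u * enorm v.
  by rewrite mulr_gt0// lt_neqAle eq_sym ?u0 ?v0 enorm_ge0.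
(* This vector vanishes exactly in the equality case, |v| u = |u| v. *)
have := inner_ge0 (enorm v *: u - enorm u *: v).
rewrite !innerE -!sqr_enorm (innerC v u) => h.
rewrite -(ler_pM2l uv0); lra.
Qed.

Lemma cauchy_schwarz_abs u v : `|inner u v| <= enorm u * enorm v.
Proof.
rewrite ler_norml cauchy_schwarz andbT lerNl -innerNl.
by rewrite (le_trans (cauchy_schwarz _ _))// enormN.
Qed.

Lemma enormD u v : enorm (u + v) <= enorm u + enorm v.
Proof.
rewrite enorm_le ?addr_ge0 ?enorm_ge0// sqrrD !sqr_enorm !innerE (innerC v u).
by have := cauchy_schwarz u v; lra.
Qed.

Lemma enorm_sub u v w : enorm (u - w) <= enorm (u - v) + enorm (v - w).
Proof. by rewrite (le_trans _ (enormD _ _))// addrA subrK. Qed.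

Lemma ler_dist_enorm u v : `|enorm u - enorm v| <= enorm (u - v).
Proof.
have h w z : enorm w - enorm z <= enorm (w - z).
  by rewrite lerBlDr -{1}(subrK z w) enormD.
by rewrite ler_norml h andbT lerNl opprB enormB h.
Qed.

Lemma enormZ a u : enorm (a *: u) = `|a| * enorm u.
Proof.
by rewrite /enorm innerZl innerZr mulrA -expr2 sqrtrM ?sqr_ge0// sqrtr_sqr.
Qed.

Lemma sqr_enormBZ (t : R) u v :
  enorm (u - t *: v) ^+ 2 =
  enorm u ^+ 2 - 2 * t * inner u v + t ^+ 2 * enorm v ^+ 2.
Proof. by rewrite !sqr_enorm !innerE (innerC v u); ring. Qed.

Lemma coord_le_enorm u i : `|u 0 i| <= enorm u.
Proof.
rewrite -sqrtr_sqr ler_wsqrtr// /inner (bigD1 i)//= -expr2 lerDl.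
by apply: sumr_ge0 => j _; rewrite -expr2 sqr_ge0.
Qed.

(** The norm carrying the topology of row vectors is the sup norm; this bound
    transfers Euclidean convergence to it. *)
Lemma norm_le_enorm u : `|u| <= enorm u.
Proof.
rewrite [leLHS]mx_normrE; apply/bigmax_leP; split => [|[i j] _] /=.
  exact: enorm_ge0.
by rewrite ord1 coord_le_enorm.
Qed.

Lemma enorm_continuous : continuous (@enorm R d).
Proof.
have cI : continuous (fun u : 'rV[R]_d => inner u u).
  apply: continuous_big => [|i _ v]; first exact: add_continuous.
  by apply: (@cvgM _ _ (nbhs v)); exact: coord_continuous.
move=> u; apply: (@continuous_comp _ _ _ _ _ u (cI u)).
exact: sqrt_continuous.
Qed.

Lemma enorm_subl_continuous v : continuous (fun u => enorm (u - v)).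
Proof.
move=> u; apply: (@continuous_comp _ _ _ (fun u => u - v)).
  apply: (@cvgB _ _ _ (nbhs u)); last exact: cvg_cst.
  exact: (@cvg_id _ (nbhs u)).
exact: enorm_continuous.
Qed.

Lemma enorm_subr_continuous v : continuous (fun u => enorm (v - u)).
Proof.
by move=> u; under eq_fun do rewrite enormB; exact: enorm_subl_continuous.
Qed.

(** Compactness makes the set of distances bounded, so that its supremum is not
    the default value of sup. *)
Lemma le_diameter (X : set 'rV[R]_d) u v :
  compact X -> X u -> X v -> enorm (u - v) <= diameter X.
Proof.
move=> cX Xu Xv; apply: sup_upper_bound; last by exists (u, v).
split; first by exists (enorm (u - v)), (u, v).
have [|c _ cmax] := @EVT_max_rV R d (fun w => enorm (w - u)) X
  (ex_intro _ u Xu) cX.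
  exact/continuous_subspaceT/enorm_subl_continuous.
exists (enorm (c - u) + enorm (c - u)) => _ [[a b] [/= Xa Xb] <-].
apply: (le_trans (enorm_sub _ u _)); rewrite (enormB u).
by apply: lerD; apply: cmax; exact: mem_set.
Qed.

Section Projection.
Variable X : set 'rV[R]_d.
Hypotheses (convexX : convex_set (X : set (convex_lmodType 'rV[R]_d)))
  (compactX : compact X) (X_neq0 : X !=set0).

(** Compactness provides a minimizer, so that get does not fall back on its
    default value. *)
Lemma projection_min u : minimizers X (fun v => enorm (u - v)) (projection X u).
Proof.
have [|c Xc cmin] := @EVT_min_rV R d (fun w => enorm (u - w)) X X_neq0 compactX.
  exact/continuous_subspaceT/enorm_subr_continuous.
apply: (@getPex _ (minimizers X (fun v => enorm (u - v)))); exists c.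
by split => [|v Xv]; [exact: set_mem|exact/cmin/mem_set].
Qed.

Lemma projection_in u : X (projection X u).
Proof. by have [] := projection_min u. Qed.

Lemma convex_segment a b (t : R) : X a -> X b -> 0 <= t <= 1 ->
  X (a + t *: (b - a)).
Proof.
move=> Xa Xb /andP[t0 t1].
have /set_mem := convexX (Itv01 t0 t1) (mem_set Xb) (mem_set Xa).
rewrite /conv/= /unstable.onem scalerBl scale1r scalerBr.
by rewrite addrCA addrA.
Qed.

(** Were the angle at the projection w acute, moving from w towards v would
    bring u closer: |u - w - t (v - w)|^2 = |u - w|^2 - 2 t s + t^2 n. *)
Lemma projection_obtuse u v : X v ->
  inner (u - projection X u) (v - projection X u) <= 0.
Proof.
set w := projection X u => Xv; rewrite leNgt; apply/negP.
set s := inner _ _ => s0; pose n := enorm (v - w) ^+ 2.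
have n0 : 0 <= n by exact: sqr_ge0.
have sn0 : 0 < s + n by exact: ltr_wpDr.
(* The optimal t is s / n; this one is at most 1 and defined when n = 0. *)
pose t := s / (s + n).
have t0 : 0 < t by rewrite divr_gt0.
have t1 : t <= 1 by rewrite ler_pdivrMr// mul1r lerDl.
have Xw : X w by exact: projection_in.
have [_ /(_ (w + t *: (v - w)))] := projection_min u.
rewrite -/w => /(_ (convex_segment Xw Xv _)); rewrite (ltW t0) t1 => /(_ isT).
rewrite -(ler_sqr (enorm_ge0 _) (enorm_ge0 _)).
rewrite (_ : u - (w + _) = u - w - t *: (v - w)); last by rewrite opprD addrA.
rewrite sqr_enormBZ -/s -/n => h.
have {}h : t * (2 * s) <= t * (t * n) by lra.
rewrite ler_pM2l// in h.
have : 2 * s * (s + n) <= s * n.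
  by move: h; rewrite /t mulrAC ler_pdivlMr.
by nra.
Qed.

(** The two obtuse-angle inequalities at u and v add up to nonexpansiveness. *)
Lemma projection_nonexpansive u v :
  enorm (projection X u - projection X v) <= enorm (u - v).
Proof.
have := projection_obtuse u (projection_in v).
have := projection_obtuse v (projection_in u).
rewrite enorm_le ?enorm_ge0// sqr_enorm.
have := inner_ge0 ((u - v) - (projection X u - projection X v)).
move: (projection X u) (projection X v) => a b.
rewrite !innerE (innerC v u) (innerC a u) (innerC b u) (innerC a v).
by rewrite (innerC b v) (innerC b a); lra.
Qed.

Lemma projection_id u : X u -> projection X u = u.
Proof.
move=> Xu; have [_ /(_ u Xu)] := projection_min u.
rewrite subrr enorm0 => h; apply/esym/eqP; rewrite -subr_eq0; apply/eqP.
by apply: enorm_eq0; apply/eqP; rewrite eq_le h enorm_ge0.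
Qed.

End Projection.
End Euclidean.

(** * One deterministic step of the method *)

Section Gradient.
Context {R : realType} {d : nat}.
Implicit Types u v : 'rV[R]_d.

(** Fermat's rule, applied to the restriction of f to the line through xs
    directed by v. *)
Lemma derive_interior_min (X : set 'rV[R]_d) (f : 'rV[R]_d -> R) xs (r : R) v :
  (forall u, differentiable f u) -> (forall u, X u -> f xs <= f u) ->
  0 < r -> [set u | enorm (u - xs) < r] `<=` X -> 'D_v f xs = 0.
Proof.
move=> fd fmin r0 rX; pose g (s : R) := f (xs + s *: v).
have quotE (t h : R) : h^-1 *: ((g \o shift t) (h *: 1) - g t) =
    h^-1 *: ((f \o shift (xs + t *: v)) (h *: v) - f (xs + t *: v)).
  rewrite /g /= [h *: 1]mulr1; congr (_ *: (f _ - _)).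
  by rewrite scalerDl addrCA.
have gder t : derivable g t 1.
  have := @diff_derivable _ _ _ f (xs + t *: v) v (fd _).
  by rewrite /derivable; under eq_fun do rewrite -quotE.
(* For |t| < c the point xs + t v stays in the ball; 1 + |v| avoids v = 0. *)
pose c := r / (1 + enorm v).
have v0 : 0 < 1 + enorm v by rewrite ltr_pwDl// enorm_ge0.
have c0 : 0 < c by rewrite divr_gt0.
have := @derive1_at_min R g (- c) c 0 _ (fun t _ => gder t) _ _.
rewrite in_itv/= oppr_lt0 c0 => /(_ _ isT) [].
- by rewrite (le_trans _ (ltW c0))// oppr_le0 ltW.
- move=> t; rewrite in_itv/= -ltr_norml => tc; rewrite /g scale0r addr0.
  apply/fmin/rX => /=; rewrite addrC addKr enormZ.
  move: tc; rewrite /c ltr_pdivlMr// => tc; apply: le_lt_trans tc.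
  by rewrite mulrDr mulr1 lerDr.
move=> _ <-; rewrite /derive; under [in RHS]eq_fun do rewrite quotE.
by rewrite scale0r addr0.
Qed.

Lemma gradient_interior_min (X : set 'rV[R]_d) (f : 'rV[R]_d -> R) xs (r : R) :
  (forall u, differentiable f u) -> (forall u, X u -> f xs <= f u) ->
  0 < r -> [set u | enorm (u - xs) < r] `<=` X -> gradient f xs = 0.
Proof.
move=> fd fmin r0 rX; apply/rowP => i.
by rewrite !mxE (derive_interior_min _ fd fmin r0 rX).
Qed.

(** The component of u along the unit vector h / |h|, and 0 when h = 0; a step
    of length eta against h decreases the squared norm of u by
    2 eta (alignment h u) up to the term eta^2. *)
Definition alignment (h u : 'rV[R]_d) : R := (enorm h)^-1 * inner h u.

Lemma alignment_ge h u : - enorm u <= alignment h u.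
Proof.
rewrite /alignment; have [->|h0] := eqVneq (enorm h) 0.
  by rewrite invr0 mul0r oppr_le0 enorm_ge0.
have hp : 0 < enorm h by rewrite lt_neqAle eq_sym h0 enorm_ge0.
rewrite ler_pdivlMl// mulrN.
by have := cauchy_schwarz_abs h u; rewrite ler_norml => /andP[].
Qed.

(** This is where the condition number enters: since the gradient vanishes at
    xs, strong convexity bounds <g, z> below by mu |z|^2 while smoothness bounds
    |g| above by beta |z|. *)
Lemma alignment_gradient (X : set 'rV[R]_d) (f : 'rV[R]_d -> R) (mu beta : R) xs u :
  0 < mu -> 0 < beta -> strongly_convex_on X f mu -> smooth_on X f beta ->
  X xs -> gradient f xs = 0 -> X u ->
  enorm (u - xs) / (beta / mu) <= alignment (gradient f u) (u - xs).
Proof.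
move=> mu0 beta0 sc sm Xxs gxs Xu.
have := sc u xs Xu Xxs; have := sm u xs Xu Xxs; rewrite gxs subr0.
set z := u - xs; set g := gradient f u => gz zg.
have [z0|z0] := eqVneq (enorm z) 0.
  rewrite z0 mul0r /alignment (enorm_eq0 z0) inner0r mulr0//.
have zp : 0 < enorm z by rewrite lt_neqAle eq_sym z0 enorm_ge0.
have gp : 0 < enorm g.
  rewrite lt_neqAle enorm_ge0 andbT; apply/eqP => /esym/enorm_eq0 g0.
  move: zg; rewrite g0 innerC inner0r leNgt.
  by rewrite mulr_gt0// exprn_gt0.
rewrite /alignment invf_div ler_pdivlMl//; apply: le_trans zg.
have k0 : 0 <= enorm z * (mu / beta) by rewrite mulr_ge0 ?divr_ge0 ?enorm_ge0 ?ltW.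
apply: le_trans (ler_wpM2r k0 gz) _; rewrite le_eqVlt; apply/orP; left.
by apply/eqP; field; exact: lt0r_neq0.
Qed.

Section Step.
Variable X : set 'rV[R]_d.
Hypotheses (convexX : convex_set (X : set (convex_lmodType 'rV[R]_d)))
  (compactX : compact X) (X_neq0 : X !=set0).

Lemma normalized_step_in eta u h : X u -> X (normalized_step X eta u h).
Proof. by rewrite /normalized_step; case: ifP => // _ _; exact: projection_in. Qed.

Lemma enorm_normalize (h : 'rV[R]_d) : 0 < enorm h -> enorm ((enorm h)^-1 *: h) = 1.
Proof. by move=> h0; rewrite enormZ ger0_norm ?invr_ge0 ?ltW// mulVf// gt_eqF. Qed.

(** The unprojected move has length eta, and u is its own projection. *)
Lemma normalized_step_move eta u h : 0 <= eta -> X u ->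
  enorm (normalized_step X eta u h - u) <= eta.
Proof.
move=> eta0 Xu; rewrite /normalized_step; case: ifPn => [h0|_]; last first.
  by rewrite subrr enorm0.
rewrite -{2}(projection_id compactX X_neq0 Xu).
apply: (le_trans (projection_nonexpansive convexX compactX X_neq0 _ _)).
by rewrite addrC addKr enormN enormZ enorm_normalize// mulr1 ger0_norm.
Qed.

(** For h = 0 the iterate does not move, the alignment is 0 and the bound still
    holds, so that no case distinction on h is needed later. *)
Lemma normalized_step_sqr_dist eta u h xs : 0 <= eta -> X xs ->
  enorm (normalized_step X eta u h - xs) ^+ 2 <=
  enorm (u - xs) ^+ 2 - 2 * eta * alignment h (u - xs) + eta ^+ 2.
Proof.
move=> eta0 Xxs; rewrite /normalized_step; case: ifPn => [h0|]; last first.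
  rewrite -leNgt => h0; have {}h0 : enorm h = 0.
    by apply/eqP; rewrite eq_le h0 enorm_ge0.
  by rewrite /alignment h0 invr0 mul0r mulr0 subr0 lerDl sqr_ge0.
rewrite -{1}(projection_id compactX X_neq0 Xxs).
apply: (@le_trans _ _ (enorm (u - eta *: ((enorm h)^-1 *: h) - xs) ^+ 2)).
  by rewrite ler_sqr ?nnegrE ?enorm_ge0// projection_nonexpansive.
rewrite addrAC sqr_enormBZ enorm_normalize// innerZr innerC -/(alignment _ _).
by rewrite expr1n mulr1.
Qed.

End Step.
End Gradient.

(** * Borel measurability of random vectors *)

Section BorelVectors.
Context {R : realType} {d : nat}.

Lemma continuous_borelV_measurable (phi : 'rV[R]_d -> R) :
  continuous phi -> measurable_fun setT (phi : borelV R d -> R).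
Proof.
move=> cphi; apply: (measurability _ (RGenOInfty.measurableE R)).
move=> /= _ [_ [a ->]] <-; rewrite setTI; apply: sub_sigma_algebra.
by move/continuousP : cphi; apply; rewrite set_itvoy; exact: open_gt.
Qed.

Context {disp : measure_display} {Om : measurableType disp}.
Implicit Types Z : Om -> 'rV[R]_d.

Lemma random_vector_continuous (phi : 'rV[R]_d -> R) Z :
  continuous phi -> random_vector Z -> measurable_fun setT (phi \o Z).
Proof.
move=> cphi mZ; apply: (@measurableT_comp _ _ _ _ (borelV R d) _ phi) => //.
exact: continuous_borelV_measurable.
Qed.

Lemma random_vector_coord Z i :
  random_vector Z -> measurable_fun setT (fun w => Z w 0 i).
Proof.
by move=> mZ; apply: (@random_vector_continuous (fun u => u 0 i)) => //;
  exact: coord_continuous.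
Qed.

(** An open set is the union of the countably many balls of rational centre and
    radius 1 / (n + 1) that it contains, and the preimage of a ball of the sup
    norm only involves coordinates. *)
Lemma coord_random_vector Z :
  (forall i, measurable_fun setT (fun w => Z w 0 i)) -> random_vector Z.
Proof.
move=> mZ; apply: (@measurability _ _ Om (borelV R d) setT Z open erefl).
move=> _ [U oU <-]; rewrite setTI.
pose B (k : 'rV[rat]_d * nat) : set 'rV[R]_d :=
  ball (map_mx (@ratr R) k.1) (k.2.+1%:R^-1).
have mB k : measurable (Z @^-1` B k).
  have -> : Z @^-1` B k = \bigcap_(i in [set: 'I_d])
      (fun w => Z w 0 i) @^-1` (ball (ratr (k.1 0 i) : R) k.2.+1%:R^-1).
    apply/seteqP; split => w.
      by move=> [_ h] i _ /=; have := h 0 i; rewrite mxE.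
    move=> h; split; first by rewrite invr_gt0.
    by move=> j i; rewrite !ord1 mxE; exact: h.
  apply: fin_bigcap_measurable => // i _; rewrite -[X in measurable X]setTI.
  by apply: mZ => //; exact: measurable_ball.
have -> : Z @^-1` U = \bigcup_(k in [set k | B k `<=` U]) Z @^-1` B k.
  apply/seteqP; split => [w Uw|w [k kU kw]]; last exact: kU.
  have [e /= e0 eU] : nbhs_ball (Z w) U by apply/nbhs_ballP; exact: open_nbhs_nbhs.
  have [n ne] : exists n, n.+1%:R^-1 < e / 2 :> R.
    have [N _ /(_ N (leqnn N)) h] := near_infty_natSinv_lt (PosNum (divr_gt0 e0 (ltr0n R 2))).
    by exists N.
  have n0 : 0 < n.+1%:R^-1 :> R by rewrite invr_gt0.
  have q i : {q : rat | `|Z w 0 i - ratr q| < n.+1%:R^-1}.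
    apply: cid; have /rat_in_itvoo[q] : Z w 0 i - n.+1%:R^-1 < Z w 0 i + n.+1%:R^-1.
      by rewrite ltrBlDr -addrA ltrDl addr_gt0.
    by rewrite in_itv/= => qi; exists q; rewrite ltr_distlC.
  exists (\row_i sval (q i), n); last first.
    split => // j i; rewrite !ord1 !mxE /= /ball/= distrC.
    exact: svalP (q i).
  move=> v [_ /= vq]; apply: eU; split => // j i; rewrite !ord1.
  have := vq 0 i; rewrite !mxE /ball/= => vqi.
  have := svalP (q i) => /= qi.
  rewrite (splitr e) (le_lt_trans (ler_distD (ratr (sval (q i))) _ _))//.
  by rewrite ltrD// (lt_trans _ ne).
rewrite bigcup_mkcond; apply: countable_bigcupT_measurable => // k.
by case: ifP.
Qed.

(** Partial derivatives are pointwise limits of the continuous difference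
    quotients of step 1 / (n + 1). *)
Lemma gradient_random_vector (f : 'rV[R]_d -> R) Z :
  (forall u, differentiable f u) -> random_vector Z ->
  random_vector (fun w => gradient f (Z w)).
Proof.
move=> fd mZ; apply: coord_random_vector => i.
pose e : 'rV[R]_d := delta_mx 0 i.
pose h (n : nat) : R := n.+1%:R^-1.
apply: (@measurable_fun_cvg _ _ _ setT
  (fun n w => (h n)^-1 * (f (h n *: e + Z w) - f (Z w)))).
  move=> n; apply: measurable_funM => //; apply: measurable_funB; last first.
    by apply: random_vector_continuous mZ => u; exact: differentiable_continuous.
  apply: (@random_vector_continuous (fun u => f (h n *: e + u))) mZ => u.
  apply: (@continuous_comp _ _ _ (fun u => h n *: e + u) f).
    by apply: (@cvgD _ _ _ (nbhs u)); [exact: cvg_cst|exact: (@cvg_id _ (nbhs u))].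
  exact: differentiable_continuous.
move=> w _; rewrite mxE.
have /= := @diff_derivable _ _ _ f (Z w) e (fd _).
move=> dfe; apply: (cvg_comp _ _ _ dfe) => A.
move=> /cvg_harmonic hA; apply: (@filterS _ \oo _ _ _ _ hA) => n; apply.
by rewrite invr_eq0 pnatr_eq0.
Qed.

End BorelVectors.

(** * Measurability of a step, independence and expectation *)

Section StepMeasurability.
Context {R : realType} {d : nat} {disp : measure_display}
  {Om : measurableType disp}.
Implicit Types u h : Om -> 'rV[R]_d.

Lemma enorm_measurable h :
  random_vector h -> measurable_fun setT (fun w => enorm (h w)).
Proof. exact/random_vector_continuous/enorm_continuous. Qed.

Section WithSet.
Variable X : set 'rV[R]_d.
Hypotheses (convexX : convex_set (X : set (convex_lmodType 'rV[R]_d)))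
  (compactX : compact X) (X_neq0 : X !=set0).

Lemma projection_coord_continuous i :
  continuous (fun u : 'rV[R]_d => projection X u 0 i).
Proof.
move=> u; apply/(@cvgrPdist_lt _ _ _ (nbhs u)) => e e0.
have /(@cvgr_dist_lt _ _ _ (nbhs u)) := @enorm_subr_continuous R d u u.
move=> /(_ e e0); apply: filterS => v.
rewrite subrr enorm0 sub0r normrN ger0_norm ?enorm_ge0//; apply: le_lt_trans.
have := coord_le_enorm (projection X u - projection X v) i.
by rewrite !mxE => /le_trans; apply; exact: projection_nonexpansive.
Qed.

Lemma projection_random_vector u :
  random_vector u -> random_vector (fun w => projection X (u w)).
Proof.
move=> mu; apply: coord_random_vector => i.
apply: (random_vector_continuous (phi := fun v => projection X v 0 i)) mu.
exact: projection_coord_continuous.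
Qed.

Lemma normalized_step_random_vector eta u h : random_vector u ->
  random_vector h -> random_vector (fun w => normalized_step X eta (u w) (h w)).
Proof.
move=> mu mh; apply: coord_random_vector => i; rewrite /normalized_step.
have mn := enorm_measurable mh.
rewrite (_ : (fun w => _) = fun w => if 0 < enorm (h w) then
    projection X (u w - eta *: ((enorm (h w))^-1 *: h w)) 0 i else u w 0 i); last first.
  by apply/funext => w; case: ifP.
apply: measurable_fun_ifT; last exact: random_vector_coord.
  exact: measurable_fun_ltr.
apply: random_vector_coord; apply: projection_random_vector.
apply: coord_random_vector => j.
(* Inversion is measurable as the power -1. *)
rewrite (_ : (fun w => _) =
    fun w => u w 0 j - eta * ((enorm (h w)) `^ (-1) * h w 0 j)); last first.
  by apply/funext => w; rewrite !mxE powR_inv1// enorm_ge0.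
apply: measurable_funB; first exact: random_vector_coord.
apply: measurable_funM => //; apply: measurable_funM.
  exact: (measurableT_comp (measurable_powR (-1))).
exact: random_vector_coord.
Qed.

End WithSet.
End StepMeasurability.

Section Independence.
Context {R : realType} {disp : measure_display} {Om : measurableType disp}
  (P : probability Om R).
Local Open Scope ereal_scope.

(** By the layer-cake formula both expectations are integrals over r >= 0 of
    tail probabilities, and for such r the event that 1_A Z exceeds r is the
    intersection of A with the event that Z exceeds r. This is why
    independence enters through tail events. *)
Lemma expectation_restrict_independent (A : set Om) (Z : Om -> R) :
  measurable A -> measurable_fun setT Z -> (forall w, (0 <= Z w)%R) ->
  (forall r : R, P (A `&` (Z @^-1` `]r, +oo[%classic)) =
     P A * P (Z @^-1` `]r, +oo[%classic)) ->
  'E_P[fun w => (\1_A w * Z w)%R] = P A * 'E_P[Z].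
Proof.
move=> mA mZ Z0 ind.
have mAZ : measurable_fun setT (fun w => (\1_A w * Z w)%R).
  by apply: measurable_funM => //; exact: measurable_indic.
pose Zr : {RV P >-> R} := mfun_Sub (mem_set mZ).
pose AZr : {RV P >-> R} := mfun_Sub (mem_set mAZ).
have -> : 'E_P[fun w => (\1_A w * Z w)%R] = 'E_P[AZr] by [].
have -> : 'E_P[Z] = 'E_P[Zr] by [].
rewrite !ge0_expectation_ccdf//=; last by move=> w; rewrite mulr_ge0.
rewrite -ge0_integralZl//; last first.
  by apply: measurable_funTS; exact: ccdf_measurable.
apply: eq_integral => r; rewrite inE/= in_itv/= andbT => r0.
rewrite /ccdf /distribution /pushforward -ind; congr (P _).
apply/seteqP; split => w /=; rewrite !in_itv/= !andbT indicE.
  case: (asboolP (A w)) => [Aw|nAw].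
    by rewrite mem_set// mul1r.
  by rewrite memNset// mul0r ltNge r0.
by move=> [Aw]; rewrite mem_set// mul1r.
Qed.

End Independence.

(** * Mean decrease of the squared distance *)

Lemma bounded_integrable (R : realType) (disp : measure_display)
    (Om : measurableType disp) (P : probability Om R) (Z : Om -> R) (M : R) :
  measurable_fun setT Z -> (forall w, `|Z w| <= M) ->
  P.-integrable setT (EFin \o Z).
Proof.
move=> mZ ZM; apply: measurable_bounded_integrable => //.
  by rewrite ltey_eq fin_num_measure.
exists M; split; first exact: num_real.
by move=> N MN w _; exact: le_trans (ZM w) (ltW MN).
Qed.

Section Method.
Context {R : realType} {d : nat} (X : set 'rV[R]_d) (f : 'rV[R]_d -> R)
  (mu beta p : R) (xs x1 : 'rV[R]_d) (step : nat -> R)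
  {disp : measure_display} {Om : measurableType disp} (P : probability Om R)
  (Y : nat -> {RV P >-> bool}) (b x : nat -> Om -> 'rV[R]_d).
Hypotheses (convexX : convex_set (X : set (convex_lmodType 'rV[R]_d)))
  (compactX : compact X) (fd : forall u : 'rV[R]_d, differentiable f u)
  (mu0 : 0 < mu) (beta0 : 0 < beta) (sc : strongly_convex_on X f mu)
  (sm : smooth_on X f beta) (Xxs : X xs) (gxs : gradient f xs = 0)
  (Xx1 : X x1) (corrupted : corruption_model p x b Y)
  (iterates : normalized_subgradient_method X step x1
     (feedback f x b (fun t => Y t : Om -> bool)) x)
  (step0 : forall t, 0 <= step t).

Let kappa := beta / mu.
Let kappa0 : 0 < kappa. Proof. by rewrite divr_gt0. Qed.
Let X0 : X !=set0. Proof. by exists xs. Qed.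

Definition dist t w := enorm (x t w - xs).
Definition corrupt t : set Om := Y t @^-1` [set true].

Lemma iterate_in t w : (1 <= t)%N -> X (x t w).
Proof.
case: t => // t _; elim: t => [|t IH]; first by rewrite (iterates.1 w).
by rewrite (iterates.2 t.+1 w)//; exact: normalized_step_in.
Qed.

Lemma dist_ge0 t w : 0 <= dist t w.
Proof. exact: enorm_ge0. Qed.

Lemma dist_le t w : (1 <= t)%N -> dist t w <= diameter X.
Proof. by move=> t1; apply: le_diameter => //; exact: iterate_in. Qed.

(** Together with the summability of the mean squared distances along a sparse
    sequence of times, this is what makes the whole sequence converge. *)
Lemma iterate_move t w : (1 <= t)%N -> enorm (x t.+1 w - x t w) <= step t.
Proof.
by move=> t1; rewrite (iterates.2 t w)// normalized_step_move//; exact: iterate_in.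
Qed.

Lemma iterate_random_vector t : (1 <= t)%N -> random_vector (x t).
Proof.
case: t => // t _; elim: t => [|t IH].
  apply: coord_random_vector => i.
  by under eq_fun do rewrite iterates.1; exact: measurable_cst.
have -> : x t.+2 = fun w => normalized_step X (step t.+1) (x t.+1 w)
    (feedback f x b (fun t => Y t : Om -> bool) t.+1 w).
  by apply/funext => w; rewrite (iterates.2 t.+1 w).
apply: normalized_step_random_vector => //.
apply: coord_random_vector => i; rewrite /feedback.
rewrite (_ : (fun w => _) = fun w => if Y t.+1 w then b t.+1 w 0 i
    else gradient f (x t.+1 w) 0 i); last by apply/funext => w; case: ifP.
apply: measurable_fun_ifT.
- exact: measurable_funP.
- by apply: random_vector_coord; have [] := corrupted (ltn0Sn t).
- apply: (random_vector_coord (Z := fun w => gradient f (x t.+1 w))).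
  exact: gradient_random_vector.
Qed.

Lemma dist_measurable t : (1 <= t)%N -> measurable_fun setT (dist t).
Proof.
move=> t1; apply: (random_vector_continuous (phi := fun v => enorm (v - xs))).
  exact: enorm_subl_continuous.
exact: iterate_random_vector.
Qed.

Lemma corrupt_measurable t : measurable (corrupt t).
Proof. by rewrite -[X in measurable X]setTI; exact: measurable_funP. Qed.

(** Merges the two cases: the alignment is at least dist / kappa on honest
    feedback and at least - dist on corrupt feedback. *)
Lemma sqr_dist_step t w : (1 <= t)%N ->
  dist t.+1 w ^+ 2 <= dist t w ^+ 2 + step t ^+ 2
    + (- (2 * step t / kappa)) * dist t w
    + (2 * step t * (1 + kappa^-1)) * (\1_(corrupt t) w * dist t w).
Proof.
move=> t1; rewrite {1}/dist (iterates.2 t w)//.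
set h := feedback _ _ _ _ _ _.
apply: (le_trans (normalized_step_sqr_dist convexX compactX X0 _ _ (step0 t) Xxs)).
suff : dist t w / kappa - (1 + kappa^-1) * (\1_(corrupt t) w * dist t w)
    <= alignment h (x t w - xs).
  by rewrite -/(dist t w) => /(ler_wpM2l (step0 t)); lra.
rewrite indicE /h /feedback; case: (boolP (Y t w)) => Yt.
  rewrite mem_set//; apply: le_trans (alignment_ge _ _).
  rewrite -/(dist t w) mul1r; move: (dist t w) (kappa^-1) => z k. lra.
rewrite memNset ?mul0r ?mulr0 ?subr0; last by rewrite /corrupt/=; exact/negP.
by apply: (alignment_gradient mu0 beta0 sc sm) => //; exact: iterate_in.
Qed.

Lemma dist_integrable t : (1 <= t)%N -> P.-integrable setT (EFin \o dist t).
Proof.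
move=> t1; apply: bounded_integrable (dist_measurable t1) _ => w.
by rewrite ger0_norm ?dist_ge0//; exact: dist_le.
Qed.

Lemma sqr_dist_integrable t : (1 <= t)%N ->
  P.-integrable setT (EFin \o (fun w => dist t w ^+ 2)).
Proof.
move=> t1; apply: (@bounded_integrable _ _ _ _ _ (diameter X ^+ 2)).
  by apply: measurable_funX; exact: dist_measurable.
move=> w; rewrite ger0_norm ?sqr_ge0// lerXn2r ?nnegrE ?dist_ge0 ?dist_le//.
by rewrite (le_trans (dist_ge0 t w))// dist_le.
Qed.

Lemma corrupt_dist_integrable t : (1 <= t)%N ->
  P.-integrable setT (EFin \o (fun w => \1_(corrupt t) w * dist t w)).
Proof.
move=> t1; apply: (@bounded_integrable _ _ _ _ _ (diameter X)).
  apply: measurable_funM; last exact: dist_measurable.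
  by apply: measurable_indic; exact: corrupt_measurable.
move=> w; rewrite normrM (ger0_norm (dist_ge0 t w)) indicE.
apply: le_trans (dist_le w t1); rewrite -[leRHS]mul1r ler_wpM2r ?dist_ge0//.
by case: (w \in _); rewrite ?normr1 ?normr0.
Qed.

(** The distance at time t is a function of the history, of which the corruption
    event at time t is independent. *)
Lemma corrupt_dist_mean t : (1 <= t)%N ->
  (\int[P]_w (\1_(corrupt t) w * dist t w) = p * \int[P]_w dist t w)%R.
Proof.
move=> t1; have [PA ind _] := corrupted t1.
have mx := iterate_random_vector t1.
have := @expectation_restrict_independent _ _ _ P _ _ (corrupt_measurable t)
  (dist_measurable t1) (dist_ge0 t).
rewrite unlock PA => h; rewrite /Rintegral h.
  by rewrite fineM//; exact: integrable_fin_num (dist_integrable t1).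
move=> r; rewrite -PA; apply: ind.
  by exists [set true] => //; rewrite setTI.
apply: sub_sigma_algebra; left; exists t; first by rewrite /= t1 leqnn.
exists ((fun v : borelV R d => enorm (v - xs)) @^-1` `]r, +oo[%classic).
  rewrite -[X in measurable X]setTI.
  by apply: continuous_borelV_measurable => //; exact: enorm_subl_continuous.
by rewrite setTI.
Qed.

(** Only the drift (1 - p) / kappa - p remains in the mean: it is positive exactly
    when p < 1 / (1 + kappa). *)
Lemma mean_sqr_dist_step t : (1 <= t)%N ->
  \int[P]_w (dist t.+1 w ^+ 2) <= \int[P]_w (dist t w ^+ 2) + step t ^+ 2
    - 2 * step t * (((1 - p) - p * kappa) / kappa) * \int[P]_w dist t w.
Proof.
move=> t1; have iV := sqr_dist_integrable t1; have iz := dist_integrable t1.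
have iAz := corrupt_dist_integrable t1.
have ic : P.-integrable setT (EFin \o (fun _ : Om => step t ^+ 2)).
  exact: (@bounded_integrable _ _ _ _ _ `|step t ^+ 2|).
have iZl k (g : Om -> R) : P.-integrable setT (EFin \o g) ->
    P.-integrable setT (EFin \o (fun w => k * g w)).
  move=> ig; under [X in _.-integrable _ X]eq_fun do rewrite /= EFinM.
  exact: integrableZl.
have iD (g h : Om -> R) : P.-integrable setT (EFin \o g) ->
    P.-integrable setT (EFin \o h) ->
    P.-integrable setT (EFin \o (fun w => g w + h w)).
  move=> ig ih; under [X in _.-integrable _ X]eq_fun do rewrite /= EFinD.
  exact: integrableD.
apply: le_trans (le_Rintegral measurableT (sqr_dist_integrable (leqW t1)) _
  (fun w _ => sqr_dist_step w t1)) _.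
  exact: (iD _ _ (iD _ _ (iD _ _ iV ic) (iZl _ _ iz)) (iZl _ _ iAz)).
rewrite (RintegralD measurableT (iD _ _ (iD _ _ iV ic) (iZl _ _ iz)) (iZl _ _ iAz)).
rewrite (RintegralD measurableT (iD _ _ iV ic) (iZl _ _ iz)).
rewrite (RintegralD measurableT iV ic).
have -> : \int[P]_w (step t ^+ 2) = step t ^+ 2.
  rewrite Rintegral_cst// (_ : fine _ = 1) ?mulr1//.
  by rewrite (congr1 fine (probability_setT P)).
rewrite (RintegralZl _ measurableT iz).
rewrite (RintegralZl _ measurableT iAz) corrupt_dist_mean//.
rewrite le_eqVlt; apply/orP; left; apply/eqP; field; exact: lt0r_neq0.
Qed.

End Method.

(** * Rates and almost sure convergence along sparse times *)

Section Rates.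
Context {R : realType}.

Lemma invn_le_lnB (n : nat) : (1 <= n)%N ->
  n.+1%:R^-1 <= ln n.+1%:R - ln n%:R :> R.
Proof.
move=> n1; have n0 : 0 < n%:R :> R by rewrite ltr0n.
have m0 : 0 < n.+1%:R :> R by rewrite ltr0n.
have : ln (1 + - n.+1%:R^-1) <= - n.+1%:R^-1 :> R.
  by apply: le_ln1Dx; rewrite ltrN2 invf_lt1// ltr1n.
have -> : 1 + - n.+1%:R^-1 = n%:R / n.+1%:R :> R.
  apply: (mulIf (lt0r_neq0 m0)); rewrite mulrBl mul1r mulfVK ?lt0r_neq0//.
  by rewrite mulVf ?lt0r_neq0// -natr1 addrK.
rewrite ln_div ?posrE//; move: (ln _) (ln _) (_^-1) => u v w. lra.
Qed.

(** The recursion telescopes after multiplication by t, as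
    t a_(t+1) <= (t - 1) a_t + g^2 / t, leaving a harmonic sum. *)
Lemma log_rate (a : nat -> R) (g : R) :
  (forall t, (1 <= t)%N -> a t.+1 <= a t + (g / t%:R) ^+ 2 - a t / t%:R) ->
  forall T, (1 <= T)%N -> T%:R * a T.+1 <= g ^+ 2 * (1 + ln T%:R).
Proof.
move=> ha; case=> // T _; elim: T => [|T IH].
  by have := ha 1%N isT; rewrite ln1 !divr1; lra.
have n0 : 0 < T.+2%:R :> R by rewrite ltr0n.
apply: le_trans (ler_wpM2l (ltW n0) (ha T.+2 isT)) _.
rewrite (_ : T.+2%:R * _ = T.+1%:R * a T.+2 + g ^+ 2 * T.+2%:R^-1); last first.
  by rewrite -[T.+2%:R]natr1 in n0 *; field; exact: lt0r_neq0.
apply: le_trans (lerD IH (ler_wpM2l (sqr_ge0 g) (invn_le_lnB (ltn0Sn T)))) _.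
by lra.
Qed.

(** Cubic times are sparse enough for (log t) / t to be summable along them, and
    dense enough for the harmonic step sizes to add up to o(1) in between. The
    successor matches a rate that bounds the distance at time T + 1. *)
Definition cube_time (n : nat) : nat := (n.+1 ^ 3).+1.

(** With m = n + 1, the inequality ln m <= m - 1 bounds the left side by 3 / m^2;
    the right side is 6 / (m (m + 1)), in a form that telescopes. *)
Lemma log_rate_cube (n : nat) :
  (1 + ln (n.+1 ^ 3)%N%:R) / (n.+1 ^ 3)%N%:R <= 6 * (n.+1%:R^-1 - n.+2%:R^-1) :> R.
Proof.
have m0 : 0 < n.+1%:R :> R by rewrite ltr0n.
rewrite natrX; have -> : ln (n.+1%:R ^+ 3) = 3 * ln n.+1%:R :> R.
  by rewrite lnXn// mulr_natl.
have hl : ln n.+1%:R <= n.+1%:R - 1 :> R.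
  rewrite -[X in ln X](addrNK 1) addrC; apply: le_ln1Dx; lra.
apply: (@le_trans _ _ (3 * n.+1%:R / n.+1%:R ^+ 3)).
  by rewrite ler_wpM2r ?invr_ge0 ?exprn_ge0 ?ltW//; lra.
rewrite -[n.+2%:R]natr1; move: m0; have : 1 <= n.+1%:R :> R by rewrite ler1n.
move: (n.+1%:R : R) => m m1 m0.
have -> : 3 * m / m ^+ 3 = 3 / m ^+ 2 by field; exact: lt0r_neq0.
have -> : 6 * (m^-1 - (m + 1)^-1) = 6 / (m * (m + 1)).
  by field; rewrite !lt0r_neq0// ltr_wpDl// ltW.
rewrite ler_pdivrMr ?exprn_gt0// mulrAC ler_pdivlMr ?mulr_gt0 ?addr_gt0//.
by nra.
Qed.

(** Between (n + 1)^3 and (n + 2)^3 there are at most 7 (n + 1)^2 steps of size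
    at most g / (n + 1)^3, so that z varies by at most 7 g / (n + 1). *)
Lemma cvg_from_cube_times (z : nat -> R) (g : R) :
  (forall t, 0 <= z t) ->
  (forall t, (1 <= t)%N -> `|z t.+1 - z t| <= g / t%:R) ->
  z (cube_time n) @[n --> \oo] --> 0 -> z t @[t --> \oo] --> 0.
Proof.
move=> z0 hz hcube.
have g0 : 0 <= g by have := hz 1%N isT; rewrite divr1; exact: le_trans.
have incr m k : (1 <= m)%N -> `|z (m + k)%N - z m| <= k%:R * (g / m%:R).
  move=> m1; elim: k => [|k IH]; first by rewrite addn0 subrr normr0 mul0r.
  rewrite addnS -natr1 mulrDl mul1r [leRHS]addrC.
  apply: le_trans (ler_distD (z (m + k)%N) _ _) _; apply: lerD => //.
  apply: le_trans (hz _ _) _; first by rewrite addn_gt0 m1.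
  rewrite ler_wpM2l// lef_pV2 ?posrE ?ltr0n ?addn_gt0 ?m1// ler_nat leq_addr//.
apply/cvgrPdist_lt => e e0.
have hc : z (cube_time n) + 7 * g * n.+1%:R^-1 @[n --> \oo] --> 0 + 7 * g * 0.
  by apply: cvgD => //; apply: cvgM; [exact: cvg_cst|exact: cvg_harmonic].
move: hc; rewrite mulr0 addr0 => /cvgrPdist_lt /(_ e e0) [N _ hN].
exists (cube_time N) => // t /= Nt.
have [n /= nt nmax] : exists2 n, (cube_time n <= t)%N &
    forall m, (cube_time m <= t)%N -> (m <= n)%N.
  have bd m : (cube_time m <= t)%N -> (m <= t)%N.
    apply: leq_trans; rewrite /cube_time ltnW// ltnS ltnW//.
    by rewrite -[X in (X <= _)%N]expn1 leq_pexp2l.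
  by case: (ex_maxnP (ex_intro _ N Nt) bd) => n; exists n.
have Nn : (N <= n)%N by exact: nmax.
have tn : (t < cube_time n.+1)%N.
  by rewrite ltnNge; apply/negP => /nmax; rewrite ltnn.
apply: le_lt_trans (hN n Nn).
rewrite !sub0r !normrN (ger0_norm (z0 t)) ger0_norm; last first.
  by rewrite addr_ge0// mulr_ge0// mulr_ge0.
have := @incr (cube_time n) (t - cube_time n)%N isT.
rewrite subnKC// ler_norml => /andP[_].
rewrite lerBlDl => /le_trans; apply; rewrite lerD2l.
have c0 : 0 < (cube_time n)%:R :> R by rewrite ltr0n.
have m1 : 1 <= n.+1%:R :> R by rewrite ler1n.
have gap : (t - cube_time n)%:R <= 7 * n.+1%:R ^+ 2 :> R.
  rewrite -natrX -natrM ler_nat leq_subLR.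
  apply: leq_trans (ltnW tn) _; rewrite /cube_time addSn ltnS.
  rewrite !expnS !expn0; nia.
have ce : n.+1%:R ^+ 3 <= (cube_time n)%:R :> R by rewrite -natrX ler_nat.
apply: (@le_trans _ _ (7 * n.+1%:R ^+ 2 * (g / n.+1%:R ^+ 3))).
  apply: ler_pM => //; first by rewrite mulr_ge0// invr_ge0 ltW.
  rewrite ler_wpM2l// lef_pV2// posrE exprn_gt0//.
rewrite le_eqVlt; apply/orP; left; apply/eqP; field; exact: lt0r_neq0.
Qed.

Context {disp : measure_display} {Om : measurableType disp}
  (P : probability Om R).

(** The means add up to at most M, so that by Tonelli the sum of the Z n is
    integrable, hence almost surely finite, and its terms tend to 0. *)
Lemma ae_cvg0_cube (Z : nat -> Om -> R) (M : R) :
  (forall n, measurable_fun setT (Z n)) -> (forall n w, 0 <= Z n w) ->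
  (forall n, (\int[P]_w (Z n w)%:E <= (M * (n.+1%:R^-1 - n.+2%:R^-1))%:E)%E) ->
  {ae P, forall w, Z n w @[n --> \oo] --> 0}.
Proof.
move=> mZ Z0 ZM; pose F w := (\sum_(n <oo) (Z n w)%:E)%E.
have mF : measurable_fun setT F.
  apply: (@ge0_emeasurable_sum _ _ _ setT (fun n w => (Z n w)%:E) xpredT).
    by move=> k w _ _; rewrite lee_fin.
  by move=> k _; exact/measurable_EFinP.
have F0 w : (0 <= F w)%E by apply: nneseries_ge0 => n _ _; rewrite lee_fin.
have M0 : 0 <= M.
  have := ZM 0%N; rewrite invr1 => h.
  have : (0 <= (M * (1 - 2^-1))%:E)%E.
    by apply: le_trans h; apply: integral_ge0 => w _; rewrite lee_fin.
  rewrite lee_fin; lra.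
have iF : P.-integrable setT F.
  apply/integrableP; split=> //.
  under eq_integral do rewrite gee0_abs//.
  rewrite integral_nneseries//; last 2 first.
  - by move=> n; exact/measurable_EFinP.
  - by move=> n w _; rewrite lee_fin.
  apply: (@le_lt_trans _ _ M%:E); last exact: ltry.
  apply: lime_le.
    by apply: is_cvg_nneseries => n _ _; apply: integral_ge0 => w _; rewrite lee_fin.
  apply: nearW => n.
  apply: (@le_trans _ _ (\sum_(0 <= k < n) (M * (k.+1%:R^-1 - k.+2%:R^-1))%:E)%E).
    by apply: lee_sum => k _; exact: ZM.
  rewrite sumEFin lee_fin -mulr_sumr.
  rewrite -[leRHS]mulr1 ler_wpM2l//.
  have -> : \sum_(0 <= k < n) (k.+1%:R^-1 - k.+2%:R^-1) = 1 - n.+1%:R^-1 :> R.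
    elim: n => [|n IH]; first by rewrite big_geq// invr1 subrr.
    by rewrite big_nat_recr//= IH addrA subrK.
  by rewrite gerBl.
have := integrable_ae measurableT iF; apply: filterS => w /(_ I) Fw.
apply: cvg_series_cvg_0; apply: nondecreasing_is_cvgn.
  apply/nondecreasing_seqP => n; rewrite /series/= big_nat_recr//= lerDl//.
exists (fine (F w)) => _ [n _ <-]; rewrite -lee_fin fineK//.
rewrite /series/= -sumEFin; apply: nneseries_lim_ge => k _ _.
by rewrite lee_fin.
Qed.

End Rates.

(** * Convergence of the method *)

Section Rate.
Context {R : realType} {d : nat} (X : set 'rV[R]_d) (f : 'rV[R]_d -> R)
  (mu beta p q : R) (xs x1 : 'rV[R]_d)
  {disp : measure_display} {Om : measurableType disp} (P : probability Om R)
  (Y : nat -> {RV P >-> bool}) (b x : nat -> Om -> 'rV[R]_d).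
Let kappa := beta / mu.
Let gamma := kappa * diameter X / (2 * ((1 - q) - q * kappa)).
Hypotheses (convexX : convex_set (X : set (convex_lmodType 'rV[R]_d)))
  (compactX : compact X) (fd : forall u : 'rV[R]_d, differentiable f u)
  (mu0 : 0 < mu) (beta0 : 0 < beta) (sc : strongly_convex_on X f mu)
  (sm : smooth_on X f beta) (Xxs : X xs) (gxs : gradient f xs = 0)
  (Xx1 : X x1) (corrupted : corruption_model p x b Y)
  (iterates : normalized_subgradient_method X (fun t => gamma / t%:R) x1
     (feedback f x b (fun t => Y t : Om -> bool)) x)
  (pq : p <= q) (q_lt : q < 1 / (1 + kappa)).

Let kappa0 : 0 < kappa. Proof. by rewrite divr_gt0. Qed.

Let margin_gt0 : 0 < (1 - q) - q * kappa.
Proof.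
move: q_lt; rewrite ltr_pdivlMr; last exact: addr_gt0.
rewrite mulrDr mulr1 -subr_gt0.
by rewrite opprD addrA.
Qed.

Let diameter_ge0 : 0 <= diameter X.
Proof. exact: le_trans (enorm_ge0 (x1 - x1)) (le_diameter compactX Xx1 Xx1). Qed.

Let gamma_ge0 : 0 <= gamma.
Proof. by apply: divr_ge0; apply: mulr_ge0 => //; exact: ltW. Qed.

Let step_ge0 t : 0 <= gamma / t%:R.
Proof. exact: divr_ge0. Qed.

(** The constant gamma is chosen for this: with it the drift term is at least
    (diameter X / t) E[dist], and dist^2 <= (diameter X) dist turns it into the
    contraction E[dist^2] / t. *)
Lemma mean_sqr_dist_recursion t : (1 <= t)%N ->
  \int[P]_w (dist xs x t.+1 w ^+ 2) <= \int[P]_w (dist xs x t w ^+ 2)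
    + (gamma / t%:R) ^+ 2 - \int[P]_w (dist xs x t w ^+ 2) / t%:R.
Proof.
move=> t1; have t0 : 0 < t%:R :> R by rewrite ltr0n.
apply: le_trans (mean_sqr_dist_step convexX compactX fd mu0 beta0 sc sm Xxs
  gxs Xx1 corrupted iterates step_ge0 t1) _.
rewrite lerD2l lerN2 -/kappa.
have iz := dist_integrable convexX compactX fd Xxs Xx1 corrupted iterates t1.
have iV := sqr_dist_integrable convexX compactX fd Xxs Xx1 corrupted iterates t1.
have hD : \int[P]_w (dist xs x t w ^+ 2) <= diameter X * \int[P]_w dist xs x t w.
  rewrite -RintegralZl//; apply: le_Rintegral => //.
    under [X in _.-integrable _ X]eq_fun do rewrite /= EFinM.
    exact: integrableZl.
  move=> w _; rewrite expr2 ler_wpM2r ?dist_ge0//.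
  exact: (dist_le compactX Xxs Xx1 iterates).
have z0 : 0 <= \int[P]_w dist xs x t w.
  by apply: Rintegral_ge0 => w _; exact: dist_ge0.
rewrite ler_pdivrMr//; apply: le_trans hD _.
rewrite [leRHS]mulrAC ler_wpM2r//.
rewrite (_ : _ * _ * t%:R = 2 * gamma * (((1 - p) - p * kappa) / kappa));
  last first.
  by field; rewrite !lt0r_neq0.
rewrite /gamma.
rewrite (_ : 2 * _ * _ =
    diameter X * ((1 - p - p * kappa) / (1 - q - q * kappa))); last first.
  by field; rewrite !lt0r_neq0.
rewrite ler_peMr// ler_pdivlMr// mul1r.
by rewrite !lerB// ler_wpM2r// ltW.
Qed.

Lemma mean_sqr_dist_rate T : (1 <= T)%N ->
  (\int[P]_w (dist xs x T.+1 w ^+ 2)%:E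
    <= (gamma ^+ 2 * (1 + ln T%:R) / T%:R)%:E)%E.
Proof.
move=> T1; have T0 : 0 < T%:R :> R by rewrite ltr0n.
have iV := sqr_dist_integrable convexX compactX fd Xxs Xx1 corrupted iterates
  (leqW T1).
have fV := integrable_fin_num measurableT iV.
rewrite -[X in (X <= _)%E]fineK// lee_fin ler_pdivlMr// mulrC.
exact: (@log_rate R (fun t => \int[P]_w (dist xs x t w ^+ 2)) gamma
  mean_sqr_dist_recursion T T1).
Qed.

(** The mean rate gives almost sure convergence along the cubic times, and the
    small moves fill the gaps. *)
Lemma iterates_ae_cvg : {ae P, forall w, x t w @[t --> \oo] --> xs}.
Proof.
have m t : (1 <= t)%N -> measurable_fun setT (dist xs x t).
  exact: (dist_measurable convexX compactX fd Xxs corrupted iterates).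
have sq_cvg : {ae P, forall w,
    dist xs x (cube_time n) w ^+ 2 @[n --> \oo] --> (0 : R)}.
  apply: (@ae_cvg0_cube R _ _ P (fun n w => dist xs x (cube_time n) w ^+ 2)
    (gamma ^+ 2 * 6)) => [n|n w|n].
  - by apply: measurable_funX; exact: m.
  - by rewrite sqr_ge0.
  - apply: le_trans (@mean_sqr_dist_rate (n.+1 ^ 3)%N _) _; first by rewrite expn_gt0.
    rewrite lee_fin -!(mulrA (gamma ^+ 2)).
    exact: (ler_wpM2l (sqr_ge0 gamma) (log_rate_cube n)).
apply: filterS sq_cvg => w cvgw.
have {}cvgw : dist xs x (cube_time n) w @[n --> \oo] --> (0 : R).
  rewrite -(sqrtr0 R).
  under eq_cvg do rewrite -(ger0_norm (dist_ge0 _ _ _ _)) -sqrtr_sqr.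
  by apply: continuous_cvg cvgw; exact: sqrt_continuous.
have dcvg : dist xs x t w @[t --> \oo] --> (0 : R).
  apply: (@cvg_from_cube_times R (fun t => dist xs x t w) gamma) => //.
    by move=> t; exact: dist_ge0.
  move=> t t1; apply: le_trans
    (iterate_move convexX compactX Xxs Xx1 iterates step_ge0 w t1).
  apply: le_trans (ler_dist_enorm _ _) _.
  by rewrite opprB addrA subrK.
apply/cvgrPdist_lt => e e0.
move/cvgrPdist_lt : dcvg => /(_ e e0); apply: filterS => t.
rewrite sub0r normrN ger0_norm ?dist_ge0//; apply: le_lt_trans.
by rewrite distrC norm_le_enorm.
Qed.

End Rate.

Theorem corollary1 (R : realType) (d : nat)
    (X : set 'rV[R]_d) (D : R) (f : 'rV[R]_d -> R)
    (mu beta kappa p q gamma : R) (xstar x1 : 'rV[R]_d)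
    (disp : measure_display) (Om : measurableType disp) (P : probability Om R)
    (Y : nat -> {RV P >-> bool}) (b x : nat -> Om -> 'rV[R]_d)
    (X_convex : convex_set (X : set (convex_lmodType 'rV[R]_d)))
    (X_compact : compact X)
    (D_def : D = diameter X)
    (f_diff : forall u : 'rV[R]_d, differentiable f u)
    (mu_gt0 : 0 < mu) (beta_gt0 : 0 < beta)
    (f_strongly_convex : strongly_convex_on X f mu)
    (f_smooth : smooth_on X f beta)
    (xstar_min : minimizers X f = [set xstar])
    (xstar_ball : exists2 r : R, 0 < r &
       [set u : 'rV[R]_d | enorm (u - xstar) < r] `<=` X)
    (kappa_def : kappa = beta / mu)
    (p_ge0 : 0 <= p) (p_lt : p < 1 / (1 + kappa))
    (q_ge : p <= q) (q_lt : q < 1 / (1 + kappa))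
    (gamma_def : gamma = kappa * D / (2 * ((1 - q) - q * kappa)))
    (x1_in : X x1)
    (corrupted : corruption_model p x b Y)
    (x_iterates : normalized_subgradient_method X (fun t => gamma / t%:R) x1
       (feedback f x b (fun t => Y t : Om -> bool)) x) :
  (forall T : nat, (1 <= T)%N ->
     ('E_P[fun w => (enorm (x T.+1 w - xstar) ^+ 2)%R]
        <= (gamma ^+ 2 * (1 + ln T%:R) / T%:R)%:E)%E) /\
  {ae P, forall w, x t w @[t --> \oo] --> xstar}.
Proof.
have [Xxs fmin] : minimizers X f xstar by rewrite xstar_min.
have [r r0 rX] := xstar_ball.
have gxs : gradient f xstar = 0 := gradient_interior_min f_diff fmin r0 rX.
subst D kappa gamma; split => [T T1|].
  rewrite unlock.
  exact: (mean_sqr_dist_rate X_convex X_compact f_diff mu_gt0 beta_gt0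
    f_strongly_convex f_smooth Xxs gxs x1_in corrupted x_iterates q_ge q_lt T1).
exact: (iterates_ae_cvg X_convex X_compact f_diff mu_gt0 beta_gt0
  f_strongly_convex f_smooth Xxs gxs x1_in corrupted x_iterates q_ge q_lt).
Qed.
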